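(* Let $G_s=(V,E,P_s)$ be a signed graph with positive signed zero forcing number $\mathcal{Z}_s^+$ and negative signed zero forcing number $\mathcal{Z}_s^-$. Then for all $A\in\mathcal{Q}_s(G_s)$, $$\Psi_{\Lambda_+(A)}(A)\le \mathcal{Z}_s^+ \quad\text{and}\quad \Psi_{\Lambda_-(A)}(A)\le \mathcal{Z}_s^-,$$ where $\Lambda_+(A)$ (resp. $\Lambda_-(A)$) is the set of positive (resp. negative) eigenvalues of $A$, and $\Psi_{\mathcal{M}}(A)$ is the maximum geometric multiplicity of the eigenvalues of $A$ belonging to $\mathcal{M}$.
   Context: **Multiplicities.** For a real eigenvalue $\lambda$ of $A\in\mathbb{R}^{n\times n}$, $\psi_A(\lambda)=\dim\{\nu\in\mathbb{R}^n:\nu^TA=\lambda\nu^T\}$ is its geometric multiplicity; $\Psi_{\mathcal{M}}(A)=\max\{\psi_A(\lambda):\lambda\in\mathcal{M}\}$ for a set $\mathcal{M}$ of eigenvalues of $A$ (taken to be $0$ if $\mathcal{M}=\emptyset$). **Sign patterns and signed graphs.** $\mathrm{sign}:\mathbb{R}\to\{+,-,0\}$ is the sign function, and $\mathrm{inv}(+)=-$, $\mathrm{inv}(-)=+$. A sign pattern $P_s$ is an $n\times n$ matrix whose off-diagonal entries lie in $\{+,-,0\}$ and whose diagonal entries lie in $\{+,-,0,?\}$. A real matrix $A\in\mathbb{R}^{n\times n}$ has sign pattern $P_s$ if $(P_s)_{ij}=\mathrm{sign}(A_{ij})$ for all $i\ne j$ and $(P_s)_{ii}=\mathrm{sign}(A_{ii})$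 whenever $(P_s)_{ii}\neq ?$; if $(P_s)_{ii}=?$, $A_{ii}$ is an arbitrary real number. A signed graph $G_s=(V,E,P_s)$ has $V=\{1,\dots,n\}$ and $(i,j)\in E$ (an edge from $i$ to $j$) iff $(P_s)_{ji}\neq 0$; the edge $(i,j)$ carries the label $(P_s)_{ji}$. Self-loops are allowed and may carry the label $+$, $-$ or $?$. $N_{out}(v)=\{u:(v,u)\in E\}$ (it contains $v$ if $v$ has a self-loop). The qualitative class $\mathcal{Q}_s(G_s)$ is the set of all real $n\times n$ matrices with sign pattern $P_s$; if $G_s$ is considered as an undirected signed graph ($P_s$ symmetric), $\mathcal{Q}_s(G_s)$ is the set of all symmetric real matrices with sign pattern $P_s$. **Looped graphs.** $P_s^{+}$ (resp. $P_s^{-}$) is obtained from $P_s$ by adding $+$ (resp. $-$) to every diagonal entry using the rules $?+s=?$, $0+s=s$, $r+r=r$, $r+\mathrm{inv}(r)=?$ for $r\in\{+,-\}$. The positive looped graph is $G_s^+=(V,E,P_s^+)$ and the negative looped graph is $G_s^-=(V,E,P_s^-)$, where the edge sets are those determined by $P_s^+$, $P_s^-$ (so every node has a self-loop). **Signing and coloring game** on a signed graph with pattern $P_s$. Each node is black or white; each white node $u$ is either marked, with $m(u)\in\{+,-\}$, or unmarked, $m(u)=*$. A node turned black has sign zero and is no longer counted as marked. Initially the nodes of a given set $Z\subseteq V$ are black, all others are white and unmarked. For $v\in V$ let $W(v)$ be the set of white out-neighbors of $v$, $W_+(v)=\{u\in W(v): m(u)=(P_s)_{uv}\}$, $W_-(v)=\{u\in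 W(v): m(u)=\mathrm{inv}((P_s)_{uv})\}$, $W_*(v)=\{u\in W(v): m(u)=*\}$. Let $v$ be a node that is either black, or white with $(P_s)_{vv}\neq ?$. The allowed moves are: 1. If $W(v)=\{u\}$, then $u$ becomes black (possibly $u=v$). 2. If $W_+(v)=W(v)$ or $W_-(v)=W(v)$, then all nodes of $W(v)$ become black. 3. If for some $s\in\{+,-\}$, $W_s(v)\ne\emptyset$, $W_{\mathrm{inv}(s)}(v)=\emptyset$ and $W_*(v)=\{w\}$, then $w$ is marked with the product of signs $(P_s)_{wv}\cdot\mathrm{inv}(s)$. 4. If no white node of the graph is marked and $u\in V$ is white, then $u$ may be marked with $+$. The moves are applied as many times as possible. The set $Z$ is a *positive signed zero forcing set* of $G_s$ if all nodes become black when the game is played on the negative looped graph $G_s^-$ (with pattern $P_s^-$ in place of $P_s$; for some sequence of moves), and a *negative signed zero forcing set* of $G_s$ if all nodes become black when the game is played on the positive looped graph $G_s^+$ (with pattern $P_s^+$; for some sequence of moves). The positive (resp. negative) signed zero forcing number $\mathcal{Z}_s^+$ (resp. $\mathcal{Z}_s^-$) is the minimum cardinality of a positive (resp. negative) signed zero forcing set of $G_s$. *)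

(* Defs.v *)
From HB Require Import structures.
From Stdlib Require Import Relation_Operators.
From mathcomp Require Import all_boot all_order all_algebra.
From mathcomp Require Import boolp classical_sets reals.

Set Implicit Arguments.
Unset Strict Implicit.
Unset Printing Implicit Defensive.

Import Order.TTheory GRing.Theory Num.Theory.

Local Open Scope ring_scope.

Inductive sgn := Plus | Minus.

Definition bool_of_sgn (s : sgn) : bool := if s is Plus then true else false.
Definition sgn_of_bool (b : bool) : sgn := if b then Plus else Minus.
Lemma bool_of_sgnK : cancel bool_of_sgn sgn_of_bool.
Proof. by case. Qed.
HB.instance Definition _ := Equality.copy sgn (can_type bool_of_sgnK).

Definition inv (s : sgn) : sgn := if s is Plus then Minus else Plus.
Definition mul_sgn (r s : sgn) : sgn := if r is Plus then s else inv s.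

(* [Unk] is the symbol "?" allowed on the diagonal of a sign pattern. *)
Inductive entry := Sgn of sgn | Zero | Unk.

Definition option_of_entry (e : entry) : option (option sgn) :=
  match e with Sgn s => Some (Some s) | Zero => Some None | Unk => None end.
Definition entry_of_option (o : option (option sgn)) : entry :=
  match o with Some (Some s) => Sgn s | Some None => Zero | None => Unk end.
Lemma option_of_entryK : cancel option_of_entry entry_of_option.
Proof. by case. Qed.
HB.instance Definition _ := Equality.copy entry (can_type option_of_entryK).

(* [Zero] and [Unk] are fixed only to make the function total. *)
Definition inv_entry (e : entry) : entry :=
  if e is Sgn s then Sgn (inv s) else e.

Definition add_entry (e : entry) (s : sgn) : entry :=
  match e with
  | Unk => Unk
  | Zero => Sgn s
  | Sgn r => if r == s then Sgn r else Unk
  end.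

Definition sign (R : realType) (x : R) : entry :=
  if 0 < x then Sgn Plus else if x < 0 then Sgn Minus else Zero.

(* The flag [undirected] records whether the graph is considered as an
   undirected one; it only matters for [qualitative_class]. *)
Record signed_graph (n : nat) := SignedGraph {
  pattern :> 'M[entry]_n;
  undirected : bool;
  pattern_offdiag : forall i j, i != j -> pattern i j != Unk;
  pattern_sym : undirected -> pattern^T = pattern
}.

Definition edge (n : nat) (G : signed_graph n) (i j : 'I_n) : bool :=
  G j i != Zero.

Definition N_out (n : nat) (G : signed_graph n) (v : 'I_n) : {set 'I_n} :=
  [set u | edge G v u].

Definition has_pattern (R : realType) (n : nat) (P : 'M[entry]_n)
    (A : 'M[R]_n) : Prop :=
  (forall i j, i != j -> P i j = sign (A i j)) /\
  (forall i, P i i != Unk -> P i i = sign (A i i)).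

Definition qualitative_class (R : realType) (n : nat) (G : signed_graph n) :
    set 'M[R]_n :=
  [set A | has_pattern G A /\ (undirected G -> A^T = A)]%classic.

Definition looped_pattern (n : nat) (P : 'M[entry]_n) (s : sgn) :
    'M[entry]_n :=
  \matrix_(i, j) if i == j then add_entry (P i j) s else P i j.

Lemma looped_offdiag (n : nat) (G : signed_graph n) (s : sgn) (i j : 'I_n) :
  i != j -> looped_pattern G s i j != Unk.
Proof. by move=> ij; rewrite mxE (negPf ij) pattern_offdiag. Qed.

Lemma looped_sym (n : nat) (G : signed_graph n) (s : sgn) :
  undirected G -> (looped_pattern G s)^T = looped_pattern G s.
Proof.
move=> /pattern_sym Gsym; apply/matrixP => i j; rewrite !mxE eq_sym.
by have -> : G j i = G i j by rewrite -[in RHS]Gsym mxE.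
Qed.

Definition looped (n : nat) (G : signed_graph n) (s : sgn) : signed_graph n :=
  SignedGraph (@looped_offdiag n G s) (@looped_sym n G s).

Inductive status := Black | Unmarked | Marked of sgn.

Definition is_white (c : status) : bool := if c is Black then false else true.
Definition is_unmarked (c : status) : bool :=
  if c is Unmarked then true else false.
Definition is_marked (c : status) : bool :=
  if c is Marked _ then true else false.
Definition marked_as (c : status) (e : entry) : bool :=
  if c is Marked r then Sgn r == e else false.

Definition state (n : nat) := 'I_n -> status.

Section Game.
Variables (n : nat) (G : signed_graph n).
Implicit Types (st : state n) (v : 'I_n) (s : sgn).

Definition W st v : {set 'I_n} := [set u in N_out G v | is_white (st u)].

(* [W_sgn st Plus v] and [W_sgn st Minus v] are W_+(v) and W_-(v). *)
Definition W_sgn st s v : {set 'I_n} :=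
  [set u in W st v |
    marked_as (st u) (if s is Plus then G u v else inv_entry (G u v))].

Definition W_star st v : {set 'I_n} := [set u in W st v | is_unmarked (st u)].

Definition active st v : bool := ~~ is_white (st v) || (G v v != Unk).

Definition blacken (S : {set 'I_n}) st : state n :=
  fun u => if u \in S then Black else st u.

Definition set_mark (w : 'I_n) s st : state n :=
  fun u => if u == w then Marked s else st u.

(* In [move_mark] the label of the edge (v, w) is never "?" : v is active, so
   w = v is possible only when the diagonal entry at v is not "?". *)
Inductive move st : state n -> Prop :=
| move_single v u :
    active st v -> W st v = [set u] -> move st (blacken [set u] st)
| move_same_sign v s :
    active st v -> W_sgn st s v = W st v -> move st (blacken (W st v) st)
| move_mark v w s r :
    active st v -> W_sgn st s v != finset.set0 -> W_sgn st (inv s) v = finset.set0 ->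
    W_star st v = [set w] -> G w v = Sgn r ->
    move st (set_mark w (mul_sgn r (inv s)) st)
| move_start u :
    (forall w, ~~ is_marked (st w)) -> is_white (st u) ->
    move st (set_mark u Plus st).

Definition initial (Z : {set 'I_n}) : state n :=
  fun u => if u \in Z then Black else Unmarked.

Definition forces (Z : {set 'I_n}) : Prop :=
  exists st, clos_refl_trans (state n) move (initial Z) st /\
    forall u, st u = Black.

End Game.

(* The positive notion is played on the negative looped graph, and vice
   versa. *)
Definition positive_szfs (n : nat) (G : signed_graph n) (Z : {set 'I_n}) :
    Prop :=
  forces (looped G Minus) Z.
Definition negative_szfs (n : nat) (G : signed_graph n) (Z : {set 'I_n}) :
    Prop :=
  forces (looped G Plus) Z.

Lemma forces_setT (n : nat) (G : signed_graph n) : forces G [set: 'I_n].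
Proof.
exists (initial [set: 'I_n]); split; first exact: rt_refl.
by move=> u; rewrite /initial inE.
Qed.

Lemma positive_szfs_ex (n : nat) (G : signed_graph n) :
  exists k, `[< exists2 Z, positive_szfs G Z & #|Z| = k >].
Proof.
exists #|[set: 'I_n]|; apply/asboolP; exists [set: 'I_n] => //.
exact: forces_setT.
Qed.

Lemma negative_szfs_ex (n : nat) (G : signed_graph n) :
  exists k, `[< exists2 Z, negative_szfs G Z & #|Z| = k >].
Proof.
exists #|[set: 'I_n]|; apply/asboolP; exists [set: 'I_n] => //.
exact: forces_setT.
Qed.

Definition positive_szf_number (n : nat) (G : signed_graph n) : nat :=
  ex_minn (positive_szfs_ex G).
Definition negative_szf_number (n : nat) (G : signed_graph n) : nat :=
  ex_minn (negative_szfs_ex G).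

(* [eigenspace A l] is the space of the row vectors u with u *m A = l *: u. *)
Definition geom_mult (R : realType) (n : nat) (A : 'M[R]_n) (l : R) : nat :=
  \rank (eigenspace A l).

Definition positive_eigenvalues (R : realType) (n : nat) (A : 'M[R]_n) :
    set R :=
  [set l | eigenvalue A l /\ 0 < l]%classic.
Definition negative_eigenvalues (R : realType) (n : nat) (A : 'M[R]_n) :
    set R :=
  [set l | eigenvalue A l /\ l < 0]%classic.

(* The maximum of { geom_mult A l | l in M }, and 0 if M is empty; bounding k
   by n loses nothing since geometric multiplicities are at most n. *)
Definition max_geom_mult (R : realType) (n : nat) (M : set R) (A : 'M[R]_n) :
    nat :=
  \max_(k < n.+1 | `[< exists2 l, M l & geom_mult A l = k >]) k.

(* Main.v *)
Require Import Defs.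
From mathcomp Require Import all_boot all_order all_algebra.
From mathcomp Require Import boolp classical_sets reals.
From mathcomp Require Import ring.

(** An eigenvalue [l] of [A] is studied through [B = A - l%:M]: for [l > 0]
    subtracting [l] pushes every diagonal entry down, so [B] has the pattern of
    the negative looped graph, and for [l < 0] that of the positive one
    ([has_pattern_sub_scalar]).  The eigenvectors are the row vectors [x] with
    [x *m B = 0].

    Column [v] of this system reads [\sum_u x_u B_uv = 0], and the moves
    made from [v] are inferences drawn from this equation.  A black node [u] records
    that [x_u = 0].  Marks record signs, up to one global sign [t] and in the
    weak sense: a mark [r] at [u] says that [t r x_u >= 0] ([explains]).  In the
    column of an active node [v] only the white out-neighbours contribute
    ([sum_white]), and their coefficients have a known nonzero sign
    ([white_entry]).  So a single white term vanishes; terms of one weak sign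
    that sum to zero all vanish; and if all terms but one have the same weak
    sign, the last one has the opposite weak sign.  The remaining move needs no
    equation: while no node is marked, [t] is still free, so it can be chosen to
    make a mark [+] at any one node correct.

    Hence a kernel vector that vanishes on a forcing set vanishes everywhere
    ([forces_eq0]): restriction to the set [Z] is injective on the eigenspace,
    whose dimension is thus at most [#|Z|] ([rank_kermx_le_card]). *)

Section SignedZeroForcing.

Set Implicit Arguments.
Unset Strict Implicit.
Unset Printing Implicit Defensive.

Import Order.TTheory GRing.Theory Num.Theory.
Local Open Scope ring_scope.
Local Notation inv := Defs.inv.

Lemma rank_kermx_le_card (F : fieldType) (n : nat) (B : 'M[F]_n)
    (Z : {set 'I_n}) :
  (forall x : 'rV[F]_n, x *m B = 0 -> {in Z, forall u, x 0 u = 0} -> x = 0) ->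
  (\rank (kermx B) <= #|Z|)%N.
Proof.
move=> Zinj.
(* Right multiplication by [S] restricts a row vector to its entries in [Z]. *)
pose S : 'M[F]_(n, #|Z|) := \matrix_(i, j) (i == enum_val j)%:R.
have SE (x : 'rV[F]_n) j : (x *m S) 0 j = x 0 (enum_val j).
  rewrite mxE (bigD1 (enum_val j)) //= mxE eqxx mulr1 big1 ?addr0 // => i ne.
  by rewrite mxE (negPf ne) mulr0.
have K0 : (kermx B :&: kermx S)%MS = 0.
  apply/eqP/rowV0P => x; rewrite sub_capmx => /andP[/sub_kermxP xB /sub_kermxP xS].
  apply: Zinj => // u uZ.
  by have := SE x (enum_rank_in uZ u); rewrite xS mxE enum_rankK_in.
by rewrite -(mxrank_mul_ker (kermx B) S) K0 mxrank0 addn0 rank_leq_col.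
Qed.

Section Signs.
Variable R : realType.

Definition sgn_val (s : sgn) : R := if s is Plus then 1 else -1.

Lemma sgn_val_inv s : sgn_val (inv s) = - sgn_val s.
Proof. by case: s; rewrite /= ?opprK. Qed.

Lemma sgn_val_mul r s : sgn_val (mul_sgn r s) = sgn_val r * sgn_val s.
Proof. by case: r; case: s; rewrite /=; ring. Qed.

Lemma sgn_val_sq s : sgn_val s * sgn_val s = 1.
Proof. by case: s; rewrite /=; ring. Qed.

Lemma sgn_val_neq0 s : sgn_val s != 0.
Proof. by case: s; rewrite /= ?oppr_eq0 oner_eq0. Qed.

Lemma sign_Sgn s (a : R) : sign a = Sgn s -> 0 < sgn_val s * a.
Proof.
rewrite /sign; case: ltP => [a0 [<-]|_]; first by rewrite mul1r.
by case: ltP => // a0 [<-]; rewrite /= mulN1r oppr_gt0.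
Qed.

Lemma sign_Zero (a : R) : sign a = Zero -> a = 0.
Proof.
by rewrite /sign; case: ltP => // a0; case: ltP => // a0' _; apply/le_anti/andP.
Qed.

(** If the sign of [a] is known and not opposite to that of [b], then [a + b]
    has the sign of [b]; in all other cases [add_entry] returns [?]. *)
Lemma add_entry_sign s (e : entry) (a b : R) :
  (e != Unk -> e = sign a) -> 0 < sgn_val s * b ->
  add_entry e s != Unk -> add_entry e s = sign (a + b).
Proof.
move=> ea sb; case: e ea => [r||] //= /(_ isT) /esym.
  move=> /sign_Sgn; have [->|//] := eqVneq r s; move=> sa _.
  have : 0 < sgn_val s * (a + b) by rewrite mulrDr addr_gt0.
  rewrite /sign; case: (s) => /=; first by rewrite mul1r => ->.
  by rewrite mulN1r oppr_gt0 => ab; rewrite ltNge (ltW ab) /= ab.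
move=> /sign_Zero -> _; rewrite add0r /sign; case: s sb => /=.
  by rewrite mul1r => ->.
by rewrite mulN1r oppr_gt0 => b0; rewrite ltNge (ltW b0) /= b0.
Qed.

End Signs.

Lemma has_pattern_sub_scalar (R : realType) (n : nat) (G : signed_graph n)
    (A : 'M[R]_n) (s : sgn) (l : R) :
  has_pattern G A -> 0 < sgn_val R s * - l ->
  has_pattern (looped G s) (A - l%:M).
Proof.
move=> [offA diagA] sl; split=> [i j ij|i].
  by rewrite !mxE (negPf ij) mulr0n subr0; apply: offA.
by rewrite !mxE eqxx mulr1n; apply: add_entry_sign => //; apply: diagA.
Qed.

Section Game.
Variables (R : realType) (n : nat) (G : signed_graph n) (B : 'M[R]_n).
Variable x : 'rV[R]_n.
Hypothesis patB : has_pattern G B.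
Hypothesis xB : x *m B = 0.

Local Notation sg := (sgn_val R).

(** The invariant of the game.  The sign [t] is needed because the kernel is
    stable under [x |-> - x], so marks can only be correct up to a common sign;
    the inequality is weak because a marked node may still turn black. *)
Definition explains (t : sgn) (st : state n) : Prop :=
  forall u, match st u with
            | Black => x 0 u = 0
            | Unmarked => True
            | Marked r => 0 <= sg t * sg r * x 0 u
            end.

(** The side condition [active] serves to exclude a white [v] whose own diagonal
    coefficient has an unknown sign. *)
Lemma white_entry st u v : active G st v -> u \in W G st v ->
  exists2 r, G u v = Sgn r & 0 < sg r * B u v.
Proof.
move=> actv; rewrite !inE /edge => /andP[nz wu].
have [nunk Euv] : G u v != Unk /\ G u v = sign (B u v).
  have [uv|uv] := eqVneq u v;
    last by split; [exact: pattern_offdiag | exact: patB.1].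
  by move: actv; rewrite -uv /active wu /= => nunk; split; last exact: patB.2.
case E: (G u v) nz nunk => [r||] // _ _.
by exists r => //; apply: sign_Sgn; rewrite -Euv.
Qed.

Lemma sum_white t st v : explains t st -> active G st v ->
  \sum_(u in W G st v) x 0 u * B u v = 0.
Proof.
move=> xst actv; have := congr1 (fun M : 'rV_n => M 0 v) xB; rewrite !mxE => x0.
rewrite -[RHS]x0 [RHS](bigID (mem (W G st v))) /= [X in _ + X]big1 ?addr0 //.
move=> u; rewrite !inE /edge negb_and negbK => /orP[/eqP Z|].
  rewrite (@sign_Zero R (B u v)) ?mulr0 // -Z.
  by have [uv|/patB.1//] := eqVneq u v; move: Z; rewrite uv => Z; rewrite -patB.2 Z.
by have := xst u; case: (st u) => //= ->; rewrite mul0r.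
Qed.

Lemma W_sgn_term_ge0 t st v s u : explains t st -> active G st v ->
  u \in W_sgn G st s v -> 0 <= sg t * sg s * (x 0 u * B u v).
Proof.
move=> xst actv; rewrite inE => /andP[uW].
have [r -> rB] := white_entry actv uW.
have := xst u; case: (st u) => //= m mx mE.
have {mE} -> : sg s = sg m * sg r.
  by case: s mE => /eqP[->]; case: (r) => /=; ring.
rewrite (_ : _ * _ = (sg t * sg m * x 0 u) * (sg r * B u v)); last by ring.
by rewrite mulr_ge0 // ltW.
Qed.

Lemma white_term_eq0 st v u : active G st v -> u \in W G st v ->
  x 0 u * B u v = 0 -> x 0 u = 0.
Proof.
move=> actv uW /eqP; rewrite mulf_eq0 => /orP[/eqP//|/eqP B0].
by have [r _] := white_entry actv uW; rewrite B0 mulr0 ltxx.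
Qed.

Lemma explains_blacken t st (S : {set 'I_n}) :
  explains t st -> {in S, forall u, x 0 u = 0} -> explains t (blacken S st).
Proof. by move=> xst S0 u; rewrite /blacken; case: ifP => [/S0|_]; last exact: xst. Qed.

Lemma explains_set_mark t st w s : explains t st ->
  0 <= sg t * sg s * x 0 w -> explains t (set_mark w s st).
Proof. by move=> xst wx u; rewrite /set_mark; case: eqP => [->|_]; last exact: xst. Qed.

Lemma same_sign_eq0 t st v s : explains t st -> active G st v ->
  W_sgn G st s v = W G st v -> {in W G st v, forall u, x 0 u = 0}.
Proof.
move=> xst actv Ws u uW; apply: (white_term_eq0 actv uW).
have F0 i : i \in W G st v -> 0 <= sg t * sg s * (x 0 i * B i v).
  by rewrite -Ws; apply: W_sgn_term_ge0.
have := sum_white xst actv; move/(congr1 ( *%R (sg t * sg s))).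
rewrite mulr0 mulr_sumr => /psumr_eq0P => /(_ F0 u uW) /eqP.
by rewrite mulf_eq0 mulf_eq0 !(negPf (sgn_val_neq0 _ _)) => /eqP.
Qed.

(** All white terms other than that of [w] carry the sign [t s], so the term of
    [w], which balances them, carries the opposite one. *)
Lemma mark_ge0 t st v w s r : explains t st -> active G st v ->
  W_sgn G st (inv s) v = finset.set0 -> W_star G st v = [set w]%SET ->
  G w v = Sgn r -> 0 <= sg t * sg (mul_sgn r (inv s)) * x 0 w.
Proof.
move=> xst actv Winv Wst Gwv.
have /[!inE]/andP[wW _] : w \in W_star G st v by rewrite Wst inE.
have {}wW : w \in W G st v by rewrite !inE.
have rest : 0 <= \sum_(u in W G st v | u != w) sg t * sg s * (x 0 u * B u v).
  apply: sumr_ge0 => u /andP[uW uw]; apply: (W_sgn_term_ge0 xst actv).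
  have uNinv : u \notin W_sgn G st (inv s) v by rewrite Winv inE.
  have uNst : u \notin W_star G st v by rewrite Wst inE.
  have [q Guv _] := white_entry actv uW.
  have uwhite : is_white (st u) by move: uW; rewrite inE => /andP[].
  move: uNinv uNst.
  rewrite [_ \in W_sgn _ _ _ _]finset.in_set [_ \in W_star _ _ _]finset.in_set.
  rewrite [u \in W_sgn _ _ s _]finset.in_set uW Guv /=.
  by case: (st u) uwhite => //= m _ + _; case: m; case: (q); case: (s).
have := sum_white xst actv; move/(congr1 ( *%R (sg t * sg s))).
rewrite mulr0 mulr_sumr (bigD1 w) //= => /eqP; rewrite addr_eq0 => /eqP sw.
have [r' ] := white_entry actv wW; rewrite Gwv => -[<-] rB.
rewrite -(pmulr_lge0 _ rB) sgn_val_mul sgn_val_inv.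
rewrite (_ : _ * _ = - (sg r * sg r * (sg t * sg s * (x 0 w * B w v)))); last by ring.
by rewrite sgn_val_sq mul1r sw opprK.
Qed.

Lemma move_explains st st' :
  move G st st' -> (exists t, explains t st) -> exists t, explains t st'.
Proof.
case=> {st'} [v u actv Wu|v s actv Ws|v w s r actv _ Winv Wst Gwv|u nomark _].
all: move=> [t xst].
- exists t; apply: explains_blacken => // _ /[!inE]/eqP->.
  have uW : u \in W G st v by rewrite Wu inE.
  apply: (white_term_eq0 actv uW).
  by have := sum_white xst actv; rewrite Wu big_set1.
- by exists t; apply: explains_blacken => //; apply: same_sign_eq0 xst actv Ws.
- by exists t; apply: explains_set_mark => //; apply: mark_ge0 xst actv _ _ Gwv.
(* In the absence of marks every sign [t] is admissible: take that of [x 0 u]. *)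
have xany t' : explains t' st.
  by move=> w; have := xst w; have := nomark w; case: (st w).
have [x0|x0] := leP 0 (x 0 u).
  by exists Plus; apply: explains_set_mark => //=; rewrite !mul1r.
by exists Minus; apply: explains_set_mark => //=; rewrite mulr1 mulN1r oppr_ge0 ltW.
Qed.

Lemma forces_eq0 (Z : {set 'I_n}) :
  forces G Z -> {in Z, forall u, x 0 u = 0} -> x = 0.
Proof.
move=> [st [play black]] Z0.
have [t xst] : exists t, explains t st.
  have : exists t, explains t (initial Z).
    by exists Plus => u; rewrite /initial; case: ifP => [/Z0|].
  elim: play => [st1 st2 /move_explains|//|st1 st2 st3 _ IH1 _ IH2 /IH1/IH2];
    exact.
by apply/rowP => u; have := xst u; rewrite black mxE.
Qed.

End Game.

Lemma geom_mult_le_card (R : realType) (n : nat) (G : signed_graph n)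
    (A : 'M[R]_n) (s : sgn) (l : R) (Z : {set 'I_n}) :
  has_pattern G A -> 0 < sgn_val R s * - l -> forces (looped G s) Z ->
  (geom_mult A l <= #|Z|)%N.
Proof.
move=> patA sl fZ; apply: rank_kermx_le_card => x xB.
exact: (forces_eq0 (G := looped G s) (has_pattern_sub_scalar patA sl) xB fZ).
Qed.

Lemma max_geom_mult_le (R : realType) (n : nat) (M : set R) (A : 'M[R]_n)
    (m : nat) :
  (forall l, M l -> (geom_mult A l <= m)%N) -> (max_geom_mult M A <= m)%N.
Proof. by move=> Mm; apply/bigmax_leqP => k /asboolP[l /Mm + <-]. Qed.

End SignedZeroForcing.

Theorem proposition2 (n : nat) (G : signed_graph n) (R : realType)
    (A : 'M[R]_n) :
  qualitative_class G A ->
  (max_geom_mult (positive_eigenvalues A) A <= positive_szf_number G)%N /\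
  (max_geom_mult (negative_eigenvalues A) A <= negative_szf_number G)%N.
Proof.
move=> [patA _]; split; apply: max_geom_mult_le => l [_ l_sign].
  rewrite /positive_szf_number; case: ex_minnP => k /asboolP[Z fZ <-] _.
  apply: (geom_mult_le_card patA _ fZ).
  by rewrite /= GRing.mulrNN GRing.mul1r.
rewrite /negative_szf_number; case: ex_minnP => k /asboolP[Z fZ <-] _.
apply: (geom_mult_le_card patA _ fZ).
by rewrite /= GRing.mul1r Num.Theory.oppr_gt0.
Qed.
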